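(* Let $k \geq 0$ and $n$ be integers with $n \geq 2k$. If $\mathcal{F}$ is a locally $k$-wide family of segments of $[n]$, then $|\mathcal{F}| \leq 2kn - 2k^2 + k + 1$. This bound is best possible: for all such $k$ and $n$ there is a locally $k$-wide family of segments of $[n]$ with exactly $2kn - 2k^2 + k + 1$ members.
   Context: $[n] = \{1,2,\dots,n\}$. A segment of $[n]$ is a subset of the form $[i,j] = \{m \in \mathbf{Z} \mid i \leq m \leq j\} \subseteq [n]$; the empty set is a segment. A family $\mathcal{F}$ of subsets of a finite set $X$ is locally $k$-wide iff for every $x \in X$ every antichain (with respect to inclusion) of $\{U \in \mathcal{F} \mid x \in U\}$ has at most $k$ members. *)

(* Defs.v *)
From mathcomp Require Import all_boot.

Set Implicit Arguments.
Unset Strict Implicit.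
Unset Printing Implicit Defensive.

(* The ground set [n] = {1, ..., n} is represented by 'I_n, the ordinal x
   standing for the integer x.+1.  The constraints 0 < i and j <= n say that
   [i, j] lies in [n]; the empty segment is the case i = 1, j = 0. *)
Definition segment (n : nat) (S : {set 'I_n}) : Prop :=
  exists i j : nat,
    [/\ 0 < i, j <= n & S = [set x : 'I_n | i <= x.+1 <= j]].

Definition antichain (T : finType) (A : {set {set T}}) : Prop :=
  {in A &, forall U V : {set T}, U \subset V -> U = V}.

Definition locally_wide (T : finType) (k : nat) (F : {set {set T}}) : Prop :=
  forall (x : T) (A : {set {set T}}),
    A \subset [set U in F | x \in U] -> antichain A -> #|A| <= k.

Definition segment_family (n : nat) (F : {set {set 'I_n}}) : Prop :=
  {in F, forall S : {set 'I_n}, segment S}.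

(* Main.v *)
(* A nonempty segment {p+1, ..., q} of [n] is a chord (p, q) with
   0 <= p < q <= n, and k+1 segments through a common point form an antichain
   iff the chords cross pairwise, p_0 < ... < p_k < q_0 < ... < q_k.

   Upper bound: read the chords as marked cells of a staircase with rows
   a = 0, ..., n and columns x > a.  Strand i enters at the top of column i and
   turns into row i when it reaches the diagonal.  At a marked cell the two
   strands bounce; at an unmarked cell they cross, unless they have crossed
   before.  Two strands cross at most once and only in an unmarked cell, so the
   number of marked cells is at most the number of inversions of the exit
   permutation e.  As for seaweed braids and longest increasing subsequences,
   the strands of label < r still present in the columns x >= r below row r - 1
   count a longest crossing of chords over the point r; there are thus at most
   k of them.  A permutation of {0, ..., n} of which at most min(k, r, n+1-r)
   elements jump over each cut r has at most 2kn - 2k^2 + k inversions.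

   Extremal family: all chords that start in {0, ..., k-1} or have length at
   most k. *)
Require Import Defs.
From mathcomp Require Import all_boot.
From mathcomp Require Import zify.

Set Implicit Arguments.
Unset Strict Implicit.
Unset Printing Implicit Defensive.

(* Row [a], with marked cells [R], sweeps the column labels [s] from left to
   right: [horiz] is the label leaving cell [x] to the right and [vert] the
   label leaving it downwards.  A label coming from the left has already crossed
   the one coming from above iff it is the larger, whence [minn] and [maxn].
   The values at columns [x < a] are junk. *)
Fixpoint horiz (R : pred nat) (s : nat -> nat) (a x : nat) : nat :=
  if x is y.+1 then
    if x <= a then s a
    else if R x then s x else minn (horiz R s a y) (s x)
  else s a.

Definition vert (R : pred nat) (s : nat -> nat) (a x : nat) : nat :=
  if x <= a then s x
  else if R x then horiz R s a x.-1 else maxn (horiz R s a x.-1) (s x).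

Fixpoint state (m : nat -> nat -> bool) (r : nat) : nat -> nat :=
  if r is a.+1 then vert (m a) (state m a) a else id.

Definition exit (m : nat -> nat -> bool) (n a : nat) : nat :=
  horiz (m a) (state m a) a n.

(** * Sweep rules and conservation of labels *)

Lemma horiz_start R s a : horiz R s a a = s a.
Proof. by case: a => [|a] //=; rewrite leqnn. Qed.

Lemma horizS R s a x : a <= x ->
  horiz R s a x.+1 =
    if R x.+1 then s x.+1 else minn (horiz R s a x) (s x.+1).
Proof. by move=> ax /=; rewrite ltnNge ax. Qed.

Arguments horiz : simpl never.

Lemma vertS R s a x : a <= x ->
  vert R s a x.+1 =
    if R x.+1 then horiz R s a x else maxn (horiz R s a x) (s x.+1).
Proof. by move=> ax; rewrite /vert ltnNge ax. Qed.

Lemma horiz_le R s a x : (forall y, s y <= y) -> a <= x -> horiz R s a x <= x.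
Proof.
move=> sle; elim: x => [|x IH]; first by case: a => [|//] _; exact: sle.
rewrite leq_eqVlt => /orP[/eqP<-|ax]; first by rewrite horiz_start.
rewrite horizS //; have := IH ax; have := sle x.+1; case: ifP => _; lia.
Qed.

Lemma state_le m r x : state m r x <= x.
Proof.
elim: r x => [|a IH] x //=; case: (leqP x a) => [xa|]; first by rewrite /vert xa.
case: x => // x ax; rewrite vertS //.
have := @horiz_le (m a) _ a x IH ax; have := IH x.+1; case: ifP => _; lia.
Qed.

(** Every cell, marked or not, permutes its two incoming labels. *)
Lemma sweep_count (P : pred nat) R s a j : a <= j ->
  \sum_(a <= x < j.+1) P (s x) =
  \sum_(a.+1 <= x < j.+1) P (vert R s a x) + P (horiz R s a j).
Proof.
elim: j => [|j IH].
  by case: a => // _; rewrite big_nat1 big_geq.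
rewrite leq_eqVlt => /orP[/eqP<-|aj].
  by rewrite big_nat1 big_geq // horiz_start.
rewrite big_nat_recr /=; last lia.
rewrite [X in _ = X + _]big_nat_recr /=; last lia.
rewrite (IH aj) horizS // vertS //.
set t := horiz _ _ _ _; set u := s _; case: ifP => _; first lia.
case: (leqP t u) => _; lia.
Qed.

(** Labels leave only at row ends. At [r = 0] the state is the identity, so [exit] permutes
    [0, ..., n]. *)
Lemma exit_count (P : pred nat) m n r : r <= n.+1 ->
  \sum_(r <= x < n.+1) P (state m r x) = \sum_(r <= b < n.+1) P (exit m n b).
Proof.
move=> rn; have [d ->] : exists d, r = n.+1 - d by exists (n.+1 - r); lia.
elim: d => [|d IH]; first by rewrite !big_geq // subn0.
case: (ltnP d n.+1) => dn; last first.
  by move: IH; rewrite (_ : n.+1 - d.+1 = n.+1 - d) //; lia.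
have e : n.+1 - d = (n.+1 - d.+1).+1 by lia.
rewrite [RHS]big_ltn; last lia.
rewrite (sweep_count P (m (n.+1 - d.+1))); last lia.
by rewrite -e -IH e addnC.
Qed.

(** * Crossing chords and displaced labels *)

(** For [r <= i] all starts lie below all ends, so increasing in both coordinates means crossing
    pairwise. *)
Definition chain (m : nat -> nat -> bool) (r i j : nat) (c : seq (nat * nat)) :=
  all (fun u => [&& m u.1 u.2, u.1 < r, i <= u.2 & u.2 < j]) c &&
  pairwise (fun u v => (u.1 < v.1) && (u.2 < v.2)) c.

Lemma chain_widen m r r' i j j' c :
  r <= r' -> j <= j' -> chain m r i j c -> chain m r' i j' c.
Proof.
move=> rr jj /andP[h p]; rewrite /chain p andbT.
by apply: sub_all h => u /and4P[-> h1 -> h2] /=; lia.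
Qed.

Lemma chain_rcons m r i j c :
  chain m r i j c -> i <= j -> m r j -> chain m r.+1 i j.+1 (rcons c (r, j)).
Proof.
move=> /[dup] + /andP[h p] ij mrj.
move=> /(chain_widen (leqnSn r) (leqnSn j)) /andP[h' _].
rewrite /chain all_rcons pairwise_rcons h' p /= mrj ij !ltnSn /= andbT.
by apply: sub_all h => u /and4P[_ -> _ ->].
Qed.

(** Induction on rows: a row raises the count by at most one, and then one of its marked cells
    extends a chain. [j] stays general so that the older chain can be cut off before that cell. *)
Lemma state_chain m r i j : r <= i ->
  exists2 c, chain m r i j c & size c = \sum_(i <= x < j) (state m r x < i).
Proof.
elim: r j => [|r IH] j ri.
  exists [::] => //=; rewrite big_nat big1 // => x /andP[ix _].
  by rewrite ltnNge ix.
case: (leqP j i) => [ji|ij]; first by exists [::] => //; rewrite big_geq.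
have {}IH := IH ^~ (ltnW ri).
set R := m r; set s := state m r; set t := horiz R s r.
have tlt : t i.-1 < i.
  have := @horiz_le R s r i.-1 (@state_le m r); rewrite -/t; lia.
(* From the last marked cell up to column [y] all labels from above are at least [i], so cutting the
   count off before that cell loses nothing. *)
have bump y : i <= y.+1 -> i <= t y ->
    exists2 c, chain m r.+1 i y.+1 c &
      size c = (\sum_(i <= x < y.+1) (s x < i)).+1.
  elim: y => [|y IHy] iy ity.
    by move: tlt; rewrite (_ : i.-1 = 0); lia.
  case: (leqP i y.+1) => iy'; last first.
    by move: tlt; rewrite (_ : i.-1 = y.+1); lia.
  have ry : r <= y by lia.
  move: ity; rewrite /t horizS // -/t.
  case: ifP => [Ry|_] ity.
    have [c hc sc] := IH y.+1; exists (rcons c (r, y.+1)).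
      exact: chain_rcons.
    by rewrite size_rcons sc [in RHS]big_nat_recr //= ltnNge ity addn0.
  have [||c hc sc] := IHy; [lia | lia |].
  exists c; first exact: chain_widen hc.
  by rewrite sc [in RHS]big_nat_recr //= (_ : s y.+1 < i = false) ?addn0 //; lia.
(* A label below [i] enters column [i] from the left; the count grows unless such a label leaves
   column [y] to the right. *)
have shift y : i <= y.+1 -> \sum_(i <= x < y.+1) (vert R s r x < i) =
    \sum_(i <= x < y.+1) (s x < i) + (i <= t y).
  elim: y => [|y IHy] iy.
    have i1 : i = 1 by lia.
    by move: tlt; rewrite i1 !big_geq //= ltnNge => /negbTE->.
  case: (leqP i y.+1) => iy'; last first.
    have iy2 : i = y.+2 by lia.
    by move: tlt; rewrite iy2 !big_geq //= ltnNge => /negbTE->.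
  rewrite big_nat_recr //= [in RHS]big_nat_recr //= IHy // vertS; last lia.
  rewrite /t horizS -/t -/s -/R; last lia.
  case: ifP => _; lia.
case: j ij => // j ij; rewrite [state _ _]/= shift; last lia.
case: (leqP i (t j)) => itj.
  by rewrite addn1; apply: bump => //; lia.
have [c hc sc] := IH j.+1; exists c; last by rewrite addn0.
exact: chain_widen hc.
Qed.

(** * Marked cells against inversions of the exit permutation *)

(** Insert the label running right between the columns swept and those to come. A marked cell keeps
    this word; an unmarked one puts two neighbours in decreasing order, destroying at most one
    ascent. *)
Lemma sweep_ascents R s a j : a <= j ->
  \sum_(a <= y < j.+1) \sum_(a <= x < y) (s x < s y) <=
  \sum_(a.+1 <= y < j.+1) \sum_(a.+1 <= x < y) (vert R s a x < vert R s a y) +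
  \sum_(a.+1 <= x < j.+1) (vert R s a x < horiz R s a j) +
  \sum_(a.+1 <= x < j.+1) ~~ R x.
Proof.
elim: j => [|j IH].
  by case: a => // _; rewrite big_nat1 big_geq.
rewrite leq_eqVlt => /orP[/eqP<-|aj].
  by rewrite big_nat1 big_geq.
rewrite big_nat_recr /=; last lia.
rewrite [X in _ <= X + _ + _]big_nat_recr /=; last lia.
rewrite [X in _ <= _ + X + _]big_nat_recr /=; last lia.
rewrite [X in _ <= _ + X]big_nat_recr /=; last lia.
have {IH} := IH aj.
rewrite (sweep_count (fun v => v < s j.+1) R) //= horizS // vertS //.
set t := horiz _ _ _ _; set u := s _.
case: ifP => /= _; first lia.
case: (leqP t u) => tu; lia.
Qed.

Lemma matches_le_inversions (m : nat -> nat -> bool) n :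
  \sum_(0 <= a < n.+1) \sum_(a.+1 <= x < n.+1) m a x <=
  \sum_(0 <= a < n.+1) \sum_(a.+1 <= b < n.+1) (exit m n b < exit m n a).
Proof.
have asc r : r <= n.+1 ->
    \sum_(0 <= y < n.+1) \sum_(0 <= x < y) (x < y) <=
    \sum_(r <= y < n.+1) \sum_(r <= x < y) (state m r x < state m r y) +
    \sum_(0 <= a < r) \sum_(a.+1 <= b < n.+1) (exit m n b < exit m n a) +
    \sum_(0 <= a < r) \sum_(a.+1 <= x < n.+1) ~~ m a x.
  elim: r => [|r IH] rn; first by rewrite !(@big_geq _ _ _ 0 0) // !addn0.
  apply: leq_trans (IH (ltnW rn)) _.
  rewrite [X in _ <= _ + X + _]big_nat_recr //= [X in _ <= _ + X]big_nat_recr //=.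
  (* Smaller labels remaining below row [r] leave from later rows and so form inversions. *)
  rewrite -(exit_count (fun v => v < exit m n r)) //=.
  have := sweep_ascents (m r) (state m r) (_ : r <= n).
  move=> /(_ rn); rewrite -/(exit m n r); lia.
have := asc n.+1 (leqnn _); rewrite [X in X + _ + _]big_geq // add0n.
(* The identity has one ascent per cell of the staircase. *)
have -> : \sum_(0 <= y < n.+1) \sum_(0 <= x < y) (x < y) =
    \sum_(0 <= a < n.+1) \sum_(a.+1 <= x < n.+1) 1.
  rewrite big_nat_rev; apply: eq_big_nat => a /= an.
  rewrite (eq_big_nat _ _ (F2 := fun=> 1)); first by rewrite !sum_nat_const_nat; lia.
  by move=> x /= ->.
have -> : \sum_(0 <= a < n.+1) \sum_(a.+1 <= x < n.+1) 1 =
    \sum_(0 <= a < n.+1) \sum_(a.+1 <= x < n.+1) m a x +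
    \sum_(0 <= a < n.+1) \sum_(a.+1 <= x < n.+1) ~~ m a x.
  rewrite -big_split; apply: eq_bigr => a _; rewrite -big_split.
  by apply: eq_bigr => x _ /=; case: (m a x).
by rewrite leq_add2r.
Qed.

(** * Inversions of a permutation with few jumps over each cut *)

Lemma double_bin2 k : 2 * 'C(k, 2) = k * k.-1.
Proof. by rewrite mulnC -[X in _ * X]/(2`!) bin_ffact ffactnS ffactn1. Qed.

(** Bounding every term on the left would overshoot by [k]. Hence one of the two copies of [G k] is
    kept on the right. *)
Lemma sum_min_le k n (G : nat -> nat) : 2 * k <= n ->
  (forall a, a <= n.+1 -> [/\ G a <= k, G a <= a & G a <= n.+1 - a]) ->
  \sum_(0 <= a < n.+1) G a + \sum_(0 <= a < n.+1) G a.+1 <=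
  2 * k * n - 2 * k ^ 2 + k + G k.
Proof.
move=> kn hG.
have end0 : G 0 = 0 by have [_ + _] := hG 0 isT; lia.
have end1 : G n.+1 = 0 by have [_ _] := hG n.+1 (leqnn _); lia.
have -> : \sum_(0 <= a < n.+1) G a.+1 = \sum_(0 <= a < n.+2) G a.
  by rewrite [RHS]big_nat_recl // end0.
have -> : \sum_(0 <= a < n.+1) G a = \sum_(0 <= a < n.+2) G a.
  by rewrite [RHS]big_nat_recr //= end1 addn0.
have -> : \sum_(0 <= a < n.+2) G a = \sum_(0 <= a < k) G a + (G k +
    (\sum_(k.+1 <= a < n.+1 - k + 1) G a + \sum_(n.+1 - k + 1 <= a < n.+2) G a)).
  rewrite (big_cat_nat (n := k)) //=; last lia.
  congr (_ + _); rewrite big_ltn; last lia.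
  by rewrite (big_cat_nat (n := n.+1 - k + 1)) //=; lia.
have lo : \sum_(0 <= a < k) G a <= 'C(k, 2).
  rewrite -bin2_sum; rewrite big_nat [leqRHS]big_nat; apply: leq_sum => a ak.
  by have [] := hG a; lia.
have mid : \sum_(k.+1 <= a < n.+1 - k + 1) G a <= (n.+1 - k + 1 - k.+1) * k.
  rewrite -sum_nat_const_nat big_nat [leqRHS]big_nat.
  apply: leq_sum => a ak.
  by have [] := hG a; lia.
have hi : \sum_(n.+1 - k + 1 <= a < n.+2) G a <= 'C(k, 2).
  rewrite -bin2_sum -[n.+1 - k + 1]add0n big_addn big_nat_rev /=.
  rewrite (_ : n.+2 - _ = k); last lia.
  rewrite big_nat [leqRHS]big_nat; apply: leq_sum => a ak.
  by have [] := hG (0 + k - a.+1 + (n.+1 - k + 1)); lia.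
have kn1 : k <= n.+1 by lia.
have [Gk _ _] := hG k kn1; have := double_bin2 k.
move: (\sum_(0 <= a < k) G a) (\sum_(k.+1 <= a < _) G a) 
  (\sum_(n.+1 - k + 1 <= a < _) G a) lo mid hi => x y z lo mid hi c2.
have [d nd] : exists d, n = 2 * k + d by exists (n - 2 * k); lia.
subst n; have -> : 2 * k * (2 * k + d) - 2 * k ^ 2 = 2 * k * k + 2 * k * d by nia.
have kk : k * k.-1 + k = k * k by case: (k) => //=; nia.
move: mid; rewrite (_ : (2 * k + d).+1 - k + 1 - k.+1 = d.+1); last lia.
nia.
Qed.

Lemma inversions_le k n (e : nat -> nat) : 2 * k <= n ->
  (forall P : pred nat,
     \sum_(0 <= a < n.+1) P (e a) = \sum_(0 <= a < n.+1) P a) ->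
  (forall r, r <= n.+1 -> \sum_(r <= b < n.+1) (e b < r) <= k) ->
  \sum_(0 <= a < n.+1) \sum_(a.+1 <= b < n.+1) (e b < e a) <=
  2 * k * n - 2 * k ^ 2 + k.
Proof.
move=> kn perm_e cut.
(* The number of elements jumping rightwards over the cut [r]; equally many
   jump leftwards. *)
pose G r := \sum_(0 <= a < n.+1) (a < r <= e a).
have count_lt r : r <= n.+1 -> \sum_(0 <= a < n.+1) (a < r) = r.
  move=> rn; rewrite (big_cat_nat (n := r)) //=.
  rewrite (eq_big_nat _ _ (F2 := fun=> 1)); last by move=> x /= ->.
  rewrite sum_nat_const_nat [X in _ + X]big_nat big1; first lia.
  by move=> x; lia.
have GE r : r <= n.+1 -> G r = \sum_(0 <= b < n.+1) (e b < r <= b).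
  move=> rn; apply/eqP.
  rewrite -(eqn_add2r (\sum_(0 <= b < n.+1) ((b < r) && (e b < r)))).
  apply/eqP; transitivity r.
    rewrite -[RHS](count_lt r) // -big_split /=; apply: eq_bigr => x _; lia.
  rewrite -[LHS](count_lt r) // -(perm_e (fun v => v < r)) -big_split /=.
  apply: eq_bigr => x _; lia.
have bounds r : r <= n.+1 -> [/\ G r <= k, G r <= r & G r <= n.+1 - r].
  move=> rn; split.
  - rewrite GE // (big_cat_nat (n := r)) //= [X in X + _]big_nat.
    rewrite big1 ?add0n; last by move=> x; lia.
    apply: leq_trans (cut r rn); apply: leq_sum => x _; lia.
  - rewrite -[leqRHS](count_lt r) //; apply: leq_sum => x _; lia.
  - rewrite GE // leq_subRL // -[X in X + _](count_lt r) // -big_split /=.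
    rewrite -[leqRHS](count_lt n.+1) // [leqRHS]big_nat [leqLHS]big_nat.
    by apply: leq_sum => x; lia.
(* Charging inversions to cuts will leave the exceedances [a < e a] unspent; they pay for the [G k]
   to be cancelled. *)
have exc : G k <= \sum_(0 <= a < n.+1) (a < e a) by apply: leq_sum => x _; lia.
rewrite -(leq_add2r (G k)); apply: leq_trans (sum_min_le kn bounds).
apply: leq_trans (leq_add (leqnn _) exc) _.
rewrite [leqRHS]addnC.
(* An inversion a < b, e b < e a satisfies a < b < e a or e b < e a <= b. *)
pose A := \sum_(0 <= a < n.+1) \sum_(0 <= b < n.+1) (a < b < e a).
pose B := \sum_(0 <= b < n.+1) \sum_(0 <= a < n.+1) (e b < e a <= b).
apply: (@leq_trans (A + B + \sum_(0 <= a < n.+1) (a < e a))).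
  rewrite leq_add2r /A /B [X in _ <= _ + X]exchange_big -big_split /=.
  apply: leq_sum => a _; rewrite -big_split /=.
  case: (leqP a n) => an; last by rewrite big_geq //; lia.
  rewrite [leqRHS](big_cat_nat (n := a.+1)) //=.
  apply: leq_trans (leq_addl _ _); rewrite [leqLHS]big_nat [leqRHS]big_nat.
  by apply: leq_sum => b; lia.
rewrite addnAC; apply: leq_add.
  (* [G b.+1] counts [a <= b < e a]; its term [a = b] is the exceedance at [b]. *)
  rewrite /A exchange_big -big_split big_nat [leqRHS]big_nat /=.
  apply: leq_sum => b bn; rewrite /G.
  rewrite (bigD1_seq b) ?[X in _ <= X](bigD1_seq b) ?iota_uniq ?mem_index_iota //=.
  rewrite ltnn ltnSn /= add0n addnC leq_add2l.
  by apply: leq_sum => a; lia.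
(* As [e] permutes the values, [e a] may be replaced by [v], the cut to charge. *)
rewrite /B [leqLHS](eq_bigr (fun b => \sum_(0 <= v < n.+1) (e b < v <= b))); last first.
  by move=> b _; exact: (perm_e (fun v => e b < v <= b)).
rewrite exchange_big big_nat [leqRHS]big_nat /=.
by apply: leq_sum => r rn; rewrite GE //; lia.
Qed.

(** * Segments as chords, and the upper bound *)

Definition arc (n p q : nat) : {set 'I_n} := [set x : 'I_n | p <= x < q].

Lemma arc_sub n p q p' q' : p < q <= n ->
  (arc n p q \subset arc n p' q') = (p' <= p) && (q <= q').
Proof.
case: q => // q /andP[pq qn]; apply/subsetP/andP => [sub | [pp qq] x].
  have pn : p < n by lia.
  have := sub (Ordinal pn); have := sub (Ordinal qn); rewrite !inE /=; lia.
by rewrite !inE; lia.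
Qed.

Lemma arc_inj n p q p' q' : p < q <= n -> p' < q' <= n ->
  arc n p q = arc n p' q' -> p = p' /\ q = q'.
Proof.
move=> h h' /eqP; rewrite eqEsubset !arc_sub //; lia.
Qed.

Lemma segment_arc n p q : q <= n -> segment (arc n p q).
Proof. by move=> qn; exists p.+1, q; split. Qed.

Lemma segment_inv n (S : {set 'I_n}) : segment S ->
  S = set0 \/ exists p q, p < q <= n /\ S = arc n p q.
Proof.
case=> [[|i] [j [//= _ jn ->]]]; case: (ltnP i j) => ij.
  by right; exists i, j; split; [lia | apply/setP=> x; rewrite !inE].
by left; apply/setP=> x; rewrite !inE; lia.
Qed.

Lemma card_arcs n (m : nat -> nat -> bool) :
  #|[set u : 'I_n.+1 * 'I_n.+1 | (u.1 < u.2) && m u.1 u.2]| =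
  \sum_(0 <= a < n.+1) \sum_(a.+1 <= x < n.+1) m a x.
Proof.
rewrite cardsE -sum1_card big_mkcond /=.
rewrite -(pair_bigA _ (fun a b : 'I_n.+1 => if (a < b) && m a b then 1 else 0)) /=.
rewrite big_mkord; apply: eq_bigr => a _.
rewrite -(big_mkord xpredT (fun b => if (a < b) && m a b then 1 else 0)).
rewrite (big_cat_nat (n := a.+1)) //= [X in X + _]big_nat big1 ?add0n.
  rewrite [LHS]big_nat [RHS]big_nat.
  by apply: eq_bigr => b /andP[-> _]; case: (m a b).
by move=> b /andP[_ ba]; rewrite ltnNge -ltnS ba.
Qed.

Lemma chain_antichain n k (F : {set {set 'I_n}}) r c :
  locally_wide k F ->
  chain (fun p q => (p < q <= n) && (arc n p q \in F)) r r n.+1 c ->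
  size c <= k.
Proof.
move=> wF /andP[/allP hc pc].
have ok u : u \in c -> u.1 < u.2 <= n by move=> /hc /and4P[/andP[]].
case: (posnP (size c)) => [->//|c0].
have /hc /and4P[/andP[u12 _] u1r ru2 _] := mem_nth (0, 0) c0.
(* All chords satisfy [p < r <= q], so their segments share the integer [r], which is the ordinal
   [r.-1]. *)
have rn : r.-1 < n by lia.
pose f u := arc n u.1 u.2.
have fE u v : u \in c -> f u \subset f v = (v.1 <= u.1) && (u.2 <= v.2).
  by move=> /ok uc; rewrite arc_sub.
have cmp u v : u \in c -> v \in c -> f u \subset f v -> u = v.
  move=> uc vc; rewrite fE //.
  move: (uc) (vc) => /(nthP (0, 0))[i ic <-] /(nthP (0, 0))[j jc <-].
  move/pairwiseP: pc => /(_ (0, 0)) pc.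
  case: (ltngtP i j) => [ij|ij|->] // /andP[].
    by have /andP[] := pc _ _ ic jc ij; rewrite ltnNge => /negP.
  by have /andP[_] := pc _ _ jc ic ij; rewrite ltnNge => /negP.
have uc : uniq c.
  rewrite uniq_pairwise; apply: sub_pairwise pc => u v /= /andP[uv _].
  by apply: contraTneq uv => ->; rewrite ltnn.
have fu : uniq (map f c).
  by rewrite map_inj_in_uniq // => u v cu cv fuv; apply: cmp => //; rewrite fuv.
rewrite -(size_map f) -(card_uniqP fu) -cardsE.
apply: (wF (Ordinal rn)).
  apply/subsetP => U; rewrite !inE => /mapP[u /hc /and4P[/andP[_ uF] h1 h2 _] ->].
  by rewrite uF inE /=; lia.
by move=> U V; rewrite !inE => /mapP[u cu ->] /mapP[v cv ->] /cmp ->.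
Qed.

Lemma locally_wide_card k n (F : {set {set 'I_n}}) : 2 * k <= n ->
  segment_family F -> locally_wide k F ->
  #|F| <= 2 * k * n - 2 * k ^ 2 + k + 1.
Proof.
move=> kn sF wF.
pose m p q := (p < q <= n) && (arc n p q \in F).
pose B := [set u : 'I_n.+1 * 'I_n.+1 | (u.1 < u.2) && m u.1 u.2].
have FB : F \subset set0 |: [set arc n u.1 u.2 | u : 'I_n.+1 * 'I_n.+1 in B].
  apply/subsetP => S SF; rewrite !inE.
  case: (segment_inv (sF S SF)) => [->|[p [q [pq Spq]]]]; first by rewrite eqxx.
  apply/orP; right; apply/imsetP.
  exists (inord p, inord q); rewrite ?inE /= /m !inordK ?pq -?Spq ?SF //; lia.
(* The extra 1 is the empty segment, which is no chord. *)
have FB1 : #|F| <= #|B| + 1.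
  apply: leq_trans (subset_leq_card FB) _; rewrite addnC.
  apply: leq_trans (leq_card_setU _ _) _.
  by rewrite cards1 leq_add2l leq_imset_card.
apply: leq_trans FB1 _; rewrite leq_add2r card_arcs.
apply: leq_trans (matches_le_inversions m n) _.
apply: inversions_le => // [P|r rn]; first by rewrite -exit_count.
rewrite -(exit_count (fun v => v < r)) //=.
have [c hc <-] := state_chain m n.+1 (leqnn r).
exact: chain_antichain wF hc.
Qed.

(** * The extremal family *)

Definition extremal_arc (k n p q : nat) :=
  (p < q <= n) && ((p < k) || (q <= p + k)).

Lemma sum_extremal_arc k n : 2 * k <= n ->
  \sum_(0 <= a < n.+1) \sum_(a.+1 <= x < n.+1) extremal_arc k n a x =
  2 * k * n - 2 * k ^ 2 + k.
Proof.
move=> kn.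
have row a d : a < n.+1 -> a + d <= n ->
    (forall x, a < x <= n -> extremal_arc k n a x = (x <= a + d)) ->
    \sum_(a.+1 <= x < n.+1) extremal_arc k n a x = d.
  move=> an ad hx; rewrite (big_cat_nat (n := (a + d).+1)) /=; try lia.
  rewrite (eq_big_nat _ _ (F2 := fun=> 1)) ?sum_nat_const_nat; last first.
    by move=> x ?; rewrite hx; lia.
  by rewrite [X in _ + X]big_nat big1; [lia | move=> x ?; rewrite hx; lia].
have sumid j : \sum_(0 <= a < j) a = 'C(j, 2) by exact: bin2_sum.
(* Rows [a < k] and [a >= n - k] contain all [n - a] possible chords, the rows between exactly
   [k]. *)
rewrite (big_cat_nat (n := k)) //=; last lia.
rewrite [X in _ + X](big_cat_nat (n := n - k)) //=; try lia.
rewrite (eq_big_nat _ _ (F2 := fun a => n - a)); last first.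
  by move=> a ak; apply: row => [||x]; rewrite /extremal_arc; lia.
rewrite [X in _ + (X + _)](eq_big_nat _ _ (F2 := fun=> k)); last first.
  by move=> a ak; apply: row => [||x]; rewrite /extremal_arc; lia.
rewrite [X in _ + (_ + X)](eq_big_nat _ _ (F2 := fun a => n - a)); last first.
  by move=> a ak; apply: row => [||x]; rewrite /extremal_arc; lia.
have lo : \sum_(0 <= a < k) (n - a) + 'C(k, 2) = k * n.
  rewrite -sumid -big_split big_nat /= (eq_bigr (fun=> n)); last by move=> i; lia.
  by rewrite -big_nat sum_nat_const_nat subn0.
have hi : \sum_(n - k <= a < n.+1) (n - a) = 'C(k.+1, 2).
  rewrite -sumid -[n - k]add0n big_addn big_nat_rev /=.
  rewrite (_ : n.+1 - (n - k) = k.+1); last lia.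
  by apply: eq_big_nat => a; lia.
rewrite hi sum_nat_const_nat.
have := double_bin2 k; rewrite binS bin1.
have kk : k * k.-1 + k = k * k by case: (k) => //=; nia.
move: lo; set x := \sum_(_ <= a < _) _ => lo c2.
have [d nd] : exists d, n = 2 * k + d by exists (n - 2 * k); lia.
move: lo; rewrite {}nd => lo.
have -> : 2 * k * (2 * k + d) - 2 * k ^ 2 = 2 * k * k + 2 * k * d.
  by rewrite expnS expn1; lia.
rewrite (_ : 2 * k + d - k - k = d); last lia.
nia.
Qed.

(** Arcs of an antichain have distinct starts, so at most [k] of them start below [k]. If one starts
    later, its length is at most [k], and the whole antichain injects into its points. *)
Lemma extremal_arcs_wide k n : locally_wide k
  (set0 |: [set arc n u.1 u.2 | u : 'I_n.+1 * 'I_n.+1 in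
              [set u : 'I_n.+1 * 'I_n.+1 | (u.1 < u.2) && extremal_arc k n u.1 u.2]]).
Proof.
move=> x A AF antiA.
pose B := [set u : 'I_n.+1 * 'I_n.+1 |
  [&& extremal_arc k n u.1 u.2, u.1 <= x < u.2 & arc n u.1 u.2 \in A]].
have AB : #|A| <= #|B|.
  apply: leq_trans (leq_imset_card (fun u : 'I_n.+1 * 'I_n.+1 => arc n u.1 u.2) _).
  apply/subset_leq_card/subsetP => U UA.
  have := subsetP AF U UA; rewrite !inE => /andP[/orP[/eqP->|]]; first by rewrite inE.
  move=> /imsetP[u]; rewrite inE => /andP[_ eu] Uu; rewrite Uu inE => xu.
  by apply/imsetP; exists u => //; rewrite inE eu xu -Uu UA.
apply: leq_trans AB _.
have nest (u v : 'I_n.+1 * 'I_n.+1) : u \in B -> v \in B ->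
    v.1 <= u.1 -> u.2 <= v.2 -> u = v.
  rewrite !inE => /and3P[/andP[eu _] _ uA] /and3P[/andP[ev _] _ vA] h1 h2.
  have /antiA uv : arc n u.1 u.2 \subset arc n v.1 v.2 by rewrite arc_sub ?h1.
  have [/val_inj + /val_inj] := arc_inj eu ev (uv uA vA).
  by case: u v {h1 h2 eu ev uA vA uv} => [? ?] [? ?] /= -> ->.
have ncmp (u v : 'I_n.+1 * 'I_n.+1) : u \in B -> v \in B ->
    [\/ u = v, u.1 < v.1 /\ u.2 < v.2 | v.1 < u.1 /\ v.2 < u.2].
  move=> uB vB.
  case: (boolP ((v.1 <= u.1) && (u.2 <= v.2))) => [/andP[h1 h2]|c1].
    by constructor 1; exact: nest.
  case: (boolP ((u.1 <= v.1) && (v.2 <= u.2))) => [/andP[h1 h2]|c2].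
    by constructor 1; rewrite (nest v u).
  by case: (leqP v.1 u.1) => h; [constructor 3 | constructor 2]; lia.
case: (boolP [forall u in B, u.1 < k]) => [/forall_inP lowB|].
  pose f (u : 'I_n.+1 * 'I_n.+1) := u.1.
  have f_inj : {in B &, injective f}.
    move=> u v uB vB /(congr1 val) /= fuv.
    by case: (ncmp u v uB vB) => // -[]; rewrite /f in fuv *; lia.
  rewrite -(card_in_imset f_inj) -(size_iota 0 k) cardE -(size_map val).
  apply: uniq_leq_size; first by rewrite map_inj_uniq ?enum_uniq //; exact: val_inj.
  move=> _ /mapP[i + ->]; rewrite mem_enum => /imsetP[u uB ->].
  by rewrite mem_iota /= add0n; exact: lowB.
rewrite negb_forall_in => /exists_inP[u0 u0B]; rewrite -leqNgt => ku0.
have [u uB ku] : exists2 u : 'I_n.+1 * 'I_n.+1, u \in B & k <= u.1 by exists u0.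
have := uB; rewrite inE => /and3P[/andP[u12 su] xu _].
(* Every other arc of [B] has exactly one endpoint strictly inside the short
   arc [u], to the left or to the right of [x]. *)
pose f (v : 'I_n.+1 * 'I_n.+1) : nat := if u.1 <= v.1 then v.1 else v.2.
(* Starts are at most [x] and ends exceed [x], so a start never collides with an end. *)
have f_inj : {in B &, injective f}.
  move=> v w vB wB; rewrite /f.
  have := ncmp v w vB wB; move: vB wB.
  rewrite !inE => /and3P[_ xv _] /and3P[_ xw _].
  by case=> [//|[]|[]] h1 h2; case: ifP => h3; case: ifP => h4 h5; exfalso; lia.
have fB (v : 'I_n.+1 * 'I_n.+1) : v \in B -> u.1 <= f v < u.2.
  move=> vB; have := ncmp u v uB vB; move: vB; rewrite inE => /and3P[_ xv _].
  by case=> [<-|[]|[]]; rewrite /f; case: ifP; lia.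
have sz : size (iota u.1 (u.2 - u.1)) <= k by rewrite size_iota; lia.
apply: leq_trans sz; rewrite cardE -(size_map f).
apply: uniq_leq_size.
  rewrite map_inj_in_uniq ?enum_uniq // => v w; rewrite !mem_enum; exact: f_inj.
move=> _ /mapP[v + ->]; rewrite mem_enum mem_iota => /fB; lia.
Qed.

Theorem theorem3p6p5 (k n : nat) (hkn : 2 * k <= n) :
  (forall F : {set {set 'I_n}},
     segment_family F -> locally_wide k F ->
     #|F| <= 2 * k * n - 2 * k ^ 2 + k + 1) /\
  (exists F : {set {set 'I_n}},
     [/\ segment_family F, locally_wide k F &
         #|F| = 2 * k * n - 2 * k ^ 2 + k + 1]).
Proof.
split=> [F|]; first exact: locally_wide_card.
pose B := [set u : 'I_n.+1 * 'I_n.+1 | (u.1 < u.2) && extremal_arc k n u.1 u.2].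
have ok u : u \in B -> u.1 < u.2 <= n by rewrite inE => /and3P[].
exists (set0 |: [set arc n u.1 u.2 | u : 'I_n.+1 * 'I_n.+1 in B]); split.
- move=> S; rewrite !inE => /orP[/eqP->|/imsetP[u _ ->]].
    by exists 1, 0; split=> //; apply/setP=> x; rewrite !inE; lia.
  by apply: segment_arc; rewrite -ltnS.
- exact: extremal_arcs_wide.
- rewrite cardsU1 addnC card_in_imset.
    rewrite card_arcs sum_extremal_arc //; congr (_ + _); apply/eqP; rewrite eqb1.
    apply/imsetP => -[u /ok /andP[u12 u2n]] /setP/(_ (Ordinal (leq_trans u12 u2n))).
    by rewrite !inE leqnn u12.
  move=> u v /ok hu /ok hv /(arc_inj hu hv) [] /val_inj + /val_inj.
  by case: u v {hu hv} => [? ?] [? ?] /= -> ->.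
Qed.
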